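(* There exist $\mathfrak{c}$ pairwise non-homeomorphic topologies $\tau\in\mathcal{L}$ such that $(\mathbb{R},\tau)$ is completely metrizable.
   Context: $\mathfrak{c}=|\mathbb{R}|$. $\eta$ denotes the Euclidean topology on $\mathbb{R}$. $\mathcal{L}$ denotes the family of all Hausdorff topologies $\tau$ on the set $\mathbb{R}$ with $\tau\subset\eta$. *)

(* Defs.v *)
From Stdlib Require Import Reals.
Open Scope R_scope.

Definition topology_on_R := (R -> Prop) -> Prop.

Definition is_topology (tau : topology_on_R) : Prop :=
  tau (fun _ => True) /\
  tau (fun _ => False) /\
  (forall U V, tau U -> tau V -> tau (fun x => U x /\ V x)) /\
  (forall (F : (R -> Prop) -> Prop),
      (forall U, F U -> tau U) -> tau (fun x => exists U, F U /\ U x)).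

Definition eta : topology_on_R := fun U =>
  forall x, U x -> exists eps, 0 < eps /\ forall y, Rabs (y - x) < eps -> U y.

Definition coarser (tau sigma : topology_on_R) : Prop :=
  forall U, tau U -> sigma U.

Definition hausdorff (tau : topology_on_R) : Prop :=
  forall x y, x <> y -> exists U V, tau U /\ tau V /\ U x /\ V y /\
    (forall z, ~ (U z /\ V z)).

Definition in_L (tau : topology_on_R) : Prop :=
  is_topology tau /\ hausdorff tau /\ coarser tau eta.

Definition is_metric (d : R -> R -> R) : Prop :=
  (forall x y, 0 <= d x y) /\
  (forall x y, d x y = 0 <-> x = y) /\
  (forall x y, d x y = d y x) /\
  (forall x y z, d x z <= d x y + d y z).

Definition metric_open (d : R -> R -> R) (U : R -> Prop) : Prop :=
  forall x, U x -> exists eps, 0 < eps /\ forall y, d x y < eps -> U y.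

Definition metric_complete (d : R -> R -> R) : Prop :=
  forall u : nat -> R,
    (forall eps, 0 < eps -> exists N, forall m n, (N <= m)%nat -> (N <= n)%nat ->
        d (u m) (u n) < eps) ->
    exists l, forall eps, 0 < eps -> exists N, forall n, (N <= n)%nat -> d (u n) l < eps.

Definition completely_metrizable (tau : topology_on_R) : Prop :=
  exists d, is_metric d /\ metric_complete d /\
    (forall U, tau U <-> metric_open d U).

Definition homeomorphic (tau sigma : topology_on_R) : Prop :=
  exists (f g : R -> R),
    (forall x, g (f x) = x) /\ (forall y, f (g y) = y) /\
    (forall V, sigma V -> tau (fun x => V (f x))) /\
    (forall U, tau U -> sigma (fun y => U (g y))).

(* Main.v *)
(** A parametrized curve [R -> X] is made to be the identity on a half-line
    [(-oo, 0]], while its tail [t > 0] sweeps over that half-line at positive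
    height, infinitely often and ever lower, touching down in the limit exactly
    on a prescribed closed set [K]. Near a point of [K] the pieces of the tail are
    clopen in a small neighborhood, so every path in [X] is continuous for the
    Euclidean topology. Hence a homeomorphism between two such spaces is a
    monotone homeomorphism of the real line carrying one set [K], recognized as
    the set of points where the topology differs from the Euclidean one, onto the
    other. For a set [S] of natural numbers let [K] have the components
    [[-n - 1/2, -n]] for [n] in [S] and [{-n}] for the other [n]: the right ends
    of the components are the numbers [-n], each is fixed, so [K] determines [S]. *)
Require Import Defs.
From Stdlib Require Import Reals Lra Lia Arith Cantor Classical.
From Coquelicot Require Import Coquelicot.
Open Scope R_scope.

(** * Paths into coarser topologies, and Euclidean continuity *)

Lemma eta_ball (x e : R) : eta (fun y => Rabs (y - x) < e).
Proof.
  intros y Hy. exists (e - Rabs (y - x)). split; [lra|].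
  intros z Hz. pose proof (Rabs_triang (z - y) (y - x)) as H.
  replace (z - y + (y - x)) with (z - x) in H by ring. lra.
Qed.

(** The supremum of the points of [P] in [[a, b]] can lie neither in [P], which would extend beyond
    it, nor in [Q], which would keep [P] away from it. *)
Lemma interval_connected (P Q : R -> Prop) (a b : R) :
  eta P -> eta Q -> a <= b -> (forall x, a <= x <= b -> P x \/ Q x) ->
  (forall x, ~ (P x /\ Q x)) -> P a -> Q b -> False.
Proof.
  intros HP HQ Hab Hcov Hdisj Pa Qb.
  destruct (completeness (fun x => a <= x <= b /\ P x)) as [m [Hub Hlub]].
  - exists b. intros x [Hx _]. lra.
  - exists a. split; [lra | exact Pa].
  - assert (Ham : a <= m) by (apply Hub; split; [lra | exact Pa]).
    assert (Hmb : m <= b) by (apply Hlub; intros x [Hx _]; lra).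
    destruct (Hcov m (conj Ham Hmb)) as [Pm | Qm].
    + destruct (HP m Pm) as [e [He Hball]].
      destruct (Req_dec m b) as [-> | Hne]; [exact (Hdisj b (conj Pm Qb))|].
      set (z := m + Rmin (e / 2) (b - m)).
      assert (Hz : m < z <= b /\ z - m < e)
        by (unfold z, Rmin; destruct Rle_dec; lra).
      enough (z <= m) by lra.
      apply Hub. split; [lra|]. apply Hball. apply Rabs_lt_between. lra.
    + destruct (HQ m Qm) as [e [He Hball]].
      enough (m <= m - e) by lra.
      apply Hlub. intros x [Hx Px].
      destruct (Rle_lt_dec x (m - e)) as [|Hlt]; [lra|]. exfalso.
      assert (x <= m) by (apply Hub; split; assumption).
      apply (Hdisj x). split; [exact Px|]. apply Hball. apply Rabs_lt_between. lra.
Qed.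

(** For [tau] coarser than [eta], this says that both topologies have the same neighborhoods of [x];
    its failure will detect [K]. *)
Definition eta_neighborhoods_at (tau : topology_on_R) (x : R) : Prop :=
  forall e, 0 < e -> exists U, tau U /\ U x /\ forall y, U y -> Rabs (y - x) < e.

(* The quasicomponent of [x] in some open set [U] stays within [e] of [x]. *)
Definition small_quasicomponents (tau : topology_on_R) : Prop :=
  forall x e, 0 < e -> exists U, tau U /\ U x /\
    forall y, U y -> e <= Rabs (y - x) ->
      exists C D, tau C /\ tau D /\ D x /\ C y /\
        (forall z, ~ (C z /\ D z)) /\ (forall z, U z -> C z \/ D z).

Definition eta_continuous (f : R -> R) : Prop :=
  forall V, eta V -> eta (fun x => V (f x)).

(** A short stretch of the path stays in [U]. If it moved a Euclidean distance [e], the separation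
    of [U] would pull back to a separation of an interval. *)
Lemma eta_continuous_of_continuous (sigma : topology_on_R) (f : R -> R) :
  small_quasicomponents sigma ->
  (forall V, sigma V -> eta (fun x => V (f x))) -> eta_continuous f.
Proof.
  intros Hsq Hf V HV t Vt.
  destruct (HV _ Vt) as [e [He Hball]].
  destruct (Hsq (f t) e He) as [U [HU [Ut Hsep]]].
  destruct (Hf U HU t Ut) as [d [Hd HdU]].
  exists d. split; [exact Hd|]. intros t' Ht'.
  apply Hball. apply Rnot_le_lt. intros Hfar.
  destruct (Hsep (f t') (HdU t' Ht') Hfar) as [C [D [HC [HD [Dx [Cy [Hdisj Hcov]]]]]]].
  apply Rabs_lt_between in Ht'.
  destruct (Rle_lt_dec t t') as [Htt | Htt].
  - apply (interval_connected _ _ t t' (Hf D HD) (Hf C HC)); auto.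
    + intros x Hx. apply or_comm, Hcov, HdU, Rabs_lt_between. lra.
    + intros x [H1 H2]. exact (Hdisj _ (conj H2 H1)).
  - apply (interval_connected _ _ t' t (Hf C HC) (Hf D HD)); auto.
    + lra.
    + intros x Hx. apply Hcov, HdU, Rabs_lt_between. lra.
Qed.

Lemma eta_neighborhoods_homeo (tau sigma : topology_on_R) (f g : R -> R) (x : R) :
  (forall x, g (f x) = x) -> (forall y, f (g y) = y) ->
  (forall U, tau U -> sigma (fun y => U (g y))) -> eta_continuous f ->
  eta_neighborhoods_at tau x -> eta_neighborhoods_at sigma (f x).
Proof.
  intros Hgf Hfg Hg Hf Hx e He.
  destruct (Hf _ (eta_ball (f x) e) x) as [d [Hd Hdf]].
  { rewrite Rminus_diag, Rabs_R0. exact He. }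
  destruct (Hx d Hd) as [U [HU [Ux HUd]]].
  exists (fun y => U (g y)). split; [exact (Hg U HU)|]. split.
  - rewrite Hgf. exact Ux.
  - intros y Hy. rewrite <- (Hfg y). apply Hdf, HUd, Hy.
Qed.

Lemma eta_continuous_continuity (f : R -> R) : eta_continuous f -> continuity f.
Proof.
  intros Hf x e He.
  destruct (Hf _ (eta_ball (f x) e) x) as [d [Hd Hdf]].
  { rewrite Rminus_diag, Rabs_R0. exact He. }
  exists d. split; [exact Hd|]. intros y [_ Hy]. apply Hdf, Hy.
Qed.

(** * Monotonicity of injective continuous functions *)

Lemma continuous_injective_monotone (f : R -> R) :
  continuity f -> (forall x y, f x = f y -> x = y) ->
  (forall x y, x < y -> f x < f y) \/ (forall x y, x < y -> f y < f x).
Proof.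
  intros Hc Hinj.
  (* Deforming the pair [(a, b)] into [(c, d)] linearly, the increment of [f] cannot change sign. *)
  assert (Hsign : forall a b c d, a < b -> c < d -> f a < f b -> f d < f c -> False).
  { intros a b c d Hab Hcd H1 H2.
    set (p := fun t => f (c + t * (a - c)) - f (d + t * (b - d))).
    assert (Hp : continuity p) by (unfold p; reg).
    destruct (IVT_gen p 0 1 0 Hp) as [t [Ht Hpt]].
    - unfold p. replace (c + 0 * (a - c)) with c by ring.
      replace (d + 0 * (b - d)) with d by ring.
      replace (c + 1 * (a - c)) with a by ring.
      replace (d + 1 * (b - d)) with b by ring.
      rewrite Rmin_right, Rmax_left; lra.
    - rewrite Rmin_left, Rmax_right in Ht by lra. unfold p in Hpt.
      assert (E : c + t * (a - c) = d + t * (b - d)) by (apply Hinj; lra).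
      destruct (Rle_lt_dec t (1 / 2)); nra. }
  assert (Hne : forall x y, x < y -> f x < f y \/ f y < f x).
  { intros x y Hxy. destruct (Rtotal_order (f x) (f y)) as [H | [H | H]]; auto.
    apply Hinj in H. lra. }
  destruct (Hne 0 1 Rlt_0_1) as [H01 | H01]; [left | right]; intros x y Hxy;
    destruct (Hne x y Hxy) as [H | H]; auto; exfalso.
  - exact (Hsign 0 1 x y Rlt_0_1 Hxy H01 H).
  - exact (Hsign x y 0 1 Hxy Rlt_0_1 H H01).
Qed.

(** * Distance to [K], and the two coordinates of the curve *)

Definition gap (K : R -> Prop) (x : R) : R :=
  real (Glb_Rbar (fun z => exists y, K y /\ z = Rabs (x - y))).

(** A point of [K] makes the infimum finite; for empty [K] it is infinite and [real] returns the
    default 0. *)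
Lemma gap_glb (K : R -> Prop) (k x : R) : K k ->
  (forall y, K y -> gap K x <= Rabs (x - y)) /\
  (forall c, (forall y, K y -> c <= Rabs (x - y)) -> c <= gap K x).
Proof.
  intros Kk. unfold gap.
  set (E := fun z => exists y, K y /\ z = Rabs (x - y)).
  destruct (Glb_Rbar_correct E) as [Hlb Hglb].
  assert (H0 : is_lb_Rbar E 0).
  { intros z [y [_ ->]]. apply Rabs_pos. }
  assert (H1 : E (Rabs (x - k))) by (exists k; auto).
  apply Hglb in H0. pose proof (Hlb _ H1) as H2.
  destruct (Glb_Rbar E) as [m | |]; simpl in *; try contradiction.
  split.
  - intros y Ky. apply (Hlb (Rabs (x - y))). exists y. auto.
  - intros c Hcb. apply (Hglb c). intros z [y [Ky ->]]. apply Hcb, Ky.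
Qed.

Lemma gap_nonneg (K : R -> Prop) (k x : R) : K k -> 0 <= gap K x.
Proof. intros Kk. apply (gap_glb K k x Kk). intros y _. apply Rabs_pos. Qed.

Lemma gap_mem (K : R -> Prop) (x : R) : K x -> gap K x = 0.
Proof.
  intros Kx. apply Rle_antisym; [|exact (gap_nonneg K x x Kx)].
  rewrite <- Rabs_R0, <- (Rminus_diag x). apply (gap_glb K x x Kx), Kx.
Qed.

Lemma gap_lipschitz (K : R -> Prop) (k x y : R) : K k ->
  Rabs (gap K x - gap K y) <= Rabs (x - y).
Proof.
  intros Kk.
  assert (H : forall u v, gap K u - Rabs (u - v) <= gap K v).
  { intros u v. apply (gap_glb K k v Kk). intros z Kz.
    pose proof (proj1 (gap_glb K k u Kk) z Kz).
    pose proof (Rabs_triang (u - v) (v - z)) as Ht.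
    replace (u - v + (v - z)) with (u - z) in Ht by ring. lra. }
  pose proof (H x y). pose proof (H y x) as H'. rewrite Rabs_minus_sym in H'.
  apply Rabs_le. lra.
Qed.

(* The logarithm makes the oscillation slow enough for [sweep] to be Lipschitz
   although its amplitude is unbounded. *)
Definition sweep (t : R) : R := t * (cos (ln (1 + t)) - 1) / 6.
Definition base (t : R) : R := Rmin t 0 + sweep (Rmax t 0).
(** Vanishes at 0, where the tail leaves the half-line, and at infinity, but is positive in
    between. *)
Definition decay (t : R) : R := Rmin t (/ (1 + t)) / 4.
Definition height (K : R -> Prop) (t : R) : R :=
  decay (Rmax t 0) + gap K (sweep (Rmax t 0)) / 2.

(** In the derivative, [cos - 1] contributes at most 2 and the term with [sin] at most 1, before the
    division by 6. *)
Lemma sweep_lipschitz (x y : R) : 0 <= x -> 0 <= y ->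
  Rabs (sweep x - sweep y) <= Rabs (x - y) / 2.
Proof.
  intros Hx Hy.
  set (df := fun t => ((cos (ln (1 + t)) - 1) - t * / (1 + t) * sin (ln (1 + t))) / 6).
  assert (Hd : forall t, 0 <= t -> is_derive sweep t (df t)).
  { intros t Ht. unfold sweep, df. auto_derive; [lra | field; lra]. }
  destruct (MVT_gen sweep y x df) as [c [Hc E]].
  - intros t Ht. apply Hd. revert Ht. unfold Rmin. destruct Rle_dec; lra.
  - intros t Ht. apply derivable_continuous_pt.
    exists (df t). apply is_derive_Reals, Hd.
    revert Ht. unfold Rmin. destruct Rle_dec; lra.
  - assert (Hc0 : 0 <= c) by (revert Hc; unfold Rmin; destruct Rle_dec; lra).
    rewrite E, Rabs_mult.
    enough (Rabs (df c) <= 1 / 2) by (pose proof (Rabs_pos (x - y)); nra).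
    assert (Hq : 0 <= c * / (1 + c) <= 1).
    { split.
      - apply Rmult_le_pos; [lra|]. left. apply Rinv_0_lt_compat. lra.
      - apply (Rmult_le_reg_r (1 + c)); [lra|]. field_simplify; lra. }
    unfold df. pose proof (COS_bound (ln (1 + c))). pose proof (SIN_bound (ln (1 + c))).
    apply Rabs_le. split; nra.
Qed.

Lemma sweep_nonpos (t : R) : 0 <= t -> sweep t <= 0.
Proof. intros Ht. unfold sweep. pose proof (COS_bound (ln (1 + t))). nra. Qed.

Lemma sweep_0 : sweep 0 = 0.
Proof. unfold sweep. lra. Qed.

Lemma decay_lipschitz (x y : R) : 0 <= x -> 0 <= y ->
  Rabs (decay x - decay y) <= Rabs (x - y) / 4.
Proof.
  assert (H : forall u v, 0 <= u <= v ->
      Rabs (decay u - decay v) <= Rabs (u - v) / 4).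
  { intros u v Huv.
    assert (0 <= / (1 + u) - / (1 + v) <= v - u).
    { replace (/ (1 + u) - / (1 + v)) with ((v - u) * / ((1 + u) * (1 + v))) by (field; lra).
      assert (0 < / ((1 + u) * (1 + v)) <= 1).
      { split; [apply Rinv_0_lt_compat; nra|].
        rewrite <- Rinv_1. apply Rinv_le_contravar; nra. }
      nra. }
    rewrite (Rabs_left1 (u - v)) by lra.
    unfold decay, Rmin. apply Rabs_le. repeat destruct Rle_dec; lra. }
  intros Hx Hy. destruct (Rle_lt_dec x y).
  - apply H. lra.
  - rewrite Rabs_minus_sym, (Rabs_minus_sym x y). apply H. lra.
Qed.

Lemma decay_0 : decay 0 = 0.
Proof. unfold decay. rewrite Rplus_0_r, Rinv_1, Rmin_left; lra. Qed.

Lemma decay_ge (m M t : R) : 0 <= m <= t -> t <= M ->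
  Rmin m (/ (1 + M)) / 4 <= decay t.
Proof.
  intros Hm HM. assert (/ (1 + M) <= / (1 + t)) by (apply Rinv_le_contravar; lra).
  unfold decay, Rmin. repeat destruct Rle_dec; lra.
Qed.

Lemma decay_ge_min_pos (m M : R) : 0 < m -> 0 <= M -> 0 < Rmin m (/ (1 + M)) / 4.
Proof.
  intros Hm HM. assert (0 < / (1 + M)) by (apply Rinv_0_lt_compat; lra).
  unfold Rmin; destruct Rle_dec; lra.
Qed.

Lemma decay_pos (t : R) : 0 < t -> 0 < decay t.
Proof.
  intros Ht. unfold decay. assert (0 < / (1 + t)) by (apply Rinv_0_lt_compat; lra).
  unfold Rmin; destruct Rle_dec; lra.
Qed.

Lemma base_nonpos_eq (t : R) : t <= 0 -> base t = t.
Proof. intros Ht. unfold base. rewrite Rmin_left, Rmax_right, sweep_0; lra. Qed.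

Lemma base_pos_eq (t : R) : 0 <= t -> base t = sweep t.
Proof. intros Ht. unfold base. rewrite Rmin_right, Rmax_left; lra. Qed.

Lemma base_le_0 (t : R) : base t <= 0.
Proof.
  unfold base. pose proof (sweep_nonpos (Rmax t 0) (Rmax_r t 0)).
  pose proof (Rmin_r t 0). lra.
Qed.

Lemma Rmin_Rmax_dist (x y : R) :
  Rabs (Rmin x 0 - Rmin y 0) + Rabs (Rmax x 0 - Rmax y 0) = Rabs (x - y).
Proof.
  unfold Rmin, Rmax. repeat destruct Rle_dec; unfold Rabs; repeat destruct Rcase_abs; lra.
Qed.

Lemma base_lipschitz (x y : R) : Rabs (base x - base y) <= Rabs (x - y).
Proof.
  pose proof (Rmin_Rmax_dist x y).
  pose proof (sweep_lipschitz (Rmax x 0) (Rmax y 0) (Rmax_r x 0) (Rmax_r y 0)).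
  pose proof (Rabs_pos (Rmax x 0 - Rmax y 0)).
  pose proof (Rabs_triang (Rmin x 0 - Rmin y 0) (sweep (Rmax x 0) - sweep (Rmax y 0))) as Ht.
  unfold base.
  replace (Rmin x 0 + sweep (Rmax x 0) - (Rmin y 0 + sweep (Rmax y 0)))
    with (Rmin x 0 - Rmin y 0 + (sweep (Rmax x 0) - sweep (Rmax y 0))) by ring.
  lra.
Qed.

Lemma base_continuity : continuity base.
Proof.
  apply eta_continuous_continuity. intros V HV x Vx.
  destruct (HV _ Vx) as [e [He Hball]]. exists e. split; [exact He|].
  intros y Hy. apply Hball. pose proof (base_lipschitz y x). lra.
Qed.

(** Where [ln (1 + t)] is an even multiple of [PI], [sweep] is 0; where it is an odd multiple,
    [sweep] is [- t / 3]. The values between are taken on the way. *)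
Lemma base_surjective_late (x N : R) : x <= 0 -> exists t, N < t /\ base t = x.
Proof.
  intros Hx.
  pose proof PI_RGT_0 as HPI. pose proof PI2_3_2 as HPI2.
  (* Beyond [- 3 * x] the minimum [- t / 3] lies below [x]. *)
  set (B := Rmax (Rabs N) (- 3 * x)).
  assert (HB : N <= B /\ - 3 * x <= B /\ 0 <= B).
  { unfold B. pose proof (Rle_abs N). pose proof (Rabs_pos N).
    pose proof (Rmax_l (Rabs N) (-3 * x)). pose proof (Rmax_r (Rabs N) (-3 * x)). lra. }
  destruct (nfloor_ex B (proj2 (proj2 HB))) as [n [_ Hn]].
  set (k := S n).
  assert (Hk : B < INR k) by (unfold k; rewrite S_INR; exact Hn).
  set (t0 := exp (0 + 2 * INR k * PI) - 1).
  set (t1 := exp (PI + 2 * INR k * PI) - 1).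
  assert (H0 : B < t0).
  { unfold t0. pose proof (exp_ineq1_le (0 + 2 * INR k * PI)). nra. }
  assert (H1 : B < t1).
  { unfold t1. pose proof (exp_ineq1_le (PI + 2 * INR k * PI)). nra. }
  destruct (IVT_gen base t0 t1 x base_continuity) as [t [Ht E]].
  - rewrite !base_pos_eq by lra. unfold sweep.
    replace (ln (1 + t0)) with (0 + 2 * INR k * PI)
      by (unfold t0; rewrite <- (ln_exp (0 + 2 * INR k * PI)) at 1; f_equal; ring).
    replace (ln (1 + t1)) with (PI + 2 * INR k * PI)
      by (unfold t1; rewrite <- (ln_exp (PI + 2 * INR k * PI)) at 1; f_equal; ring).
    rewrite !cos_period, cos_0, cos_PI.
    rewrite Rmin_right, Rmax_left; lra.
  - exists t. split; [|exact E]. revert Ht. unfold Rmin. destruct Rle_dec; lra.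
Qed.

Lemma height_nonpos_eq (K : R -> Prop) (t : R) : K 0 -> t <= 0 -> height K t = 0.
Proof.
  intros K0 Ht. unfold height.
  rewrite Rmax_right, decay_0, sweep_0, (gap_mem K 0 K0) by lra. lra.
Qed.

Lemma height_ge_decay (K : R -> Prop) (t : R) : K 0 -> 0 <= t -> decay t <= height K t.
Proof.
  intros K0 Ht. unfold height. rewrite Rmax_left by lra.
  pose proof (gap_nonneg K 0 (sweep t) K0). lra.
Qed.

Lemma height_pos (K : R -> Prop) (t : R) : K 0 -> 0 < t -> 0 < height K t.
Proof.
  intros K0 Ht. apply Rlt_le_trans with (decay t).
  - apply decay_pos, Ht.
  - apply height_ge_decay; [exact K0 | lra].
Qed.

Lemma height_nonneg (K : R -> Prop) (t : R) : K 0 -> 0 <= height K t.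
Proof.
  intros K0. destruct (Rle_lt_dec t 0).
  - rewrite height_nonpos_eq; auto. lra.
  - left. apply height_pos; auto.
Qed.

(** The constants are chosen for this bound: on the tail [sweep] uses 1/2 of the Lipschitz budget,
    [decay] 1/4, and half of [gap] after [sweep] another 1/4. *)
Lemma height_base_lipschitz (K : R -> Prop) (x y : R) : K 0 ->
  Rabs (height K x - height K y) + Rabs (base x - base y) <= Rabs (x - y).
Proof.
  intros K0. rewrite <- (Rmin_Rmax_dist x y).
  pose proof (Rmax_r x 0) as Hx. pose proof (Rmax_r y 0) as Hy.
  unfold height, base.
  set (u := Rmax x 0) in *. set (v := Rmax y 0) in *.
  pose proof (sweep_lipschitz u v Hx Hy) as H1.
  pose proof (decay_lipschitz u v Hx Hy) as H2.
  pose proof (gap_lipschitz K 0 (sweep u) (sweep v) K0) as H3.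
  assert (H4 : Rabs (decay u + gap K (sweep u) / 2 - (decay v + gap K (sweep v) / 2))
      <= Rabs (decay u - decay v) + Rabs (gap K (sweep u) - gap K (sweep v)) / 2).
  { unfold Rabs; repeat destruct Rcase_abs; lra. }
  pose proof (Rabs_triang (Rmin x 0 - Rmin y 0) (sweep u - sweep v)) as H5.
  replace (Rmin x 0 - Rmin y 0 + (sweep u - sweep v))
    with (Rmin x 0 + sweep u - (Rmin y 0 + sweep v)) in H5 by ring.
  lra.
Qed.

(** * The metric on the curve and its completeness *)

(* Length of the jump between two sheets of the curve through the ground line. *)
Definition hop (K : R -> Prop) (x y : R) : R :=
  height K x + height K y + Rabs (base x - base y).

(** The shorter of moving along the parameter line and hopping once. A hop runs as in the jungle
    river metric of the plane: down to the line, along it and up again. *)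
Definition river (K : R -> Prop) (x y : R) : R := Rmin (Rabs (x - y)) (hop K x y).

Lemma river_lt (K : R -> Prop) (x y e : R) :
  river K x y < e <-> Rabs (x - y) < e \/ hop K x y < e.
Proof. unfold river, Rmin. destruct Rle_dec; lra. Qed.

Lemma river_le (K : R -> Prop) (x y : R) :
  river K x y <= Rabs (x - y) /\ river K x y <= hop K x y.
Proof. split; [apply Rmin_l | apply Rmin_r]. Qed.

(** Together with the bound for [height], this makes the two coordinates of a Cauchy sequence
    converge. *)
Lemma river_ge_base (K : R -> Prop) (x y : R) : K 0 ->
  Rabs (base x - base y) <= river K x y.
Proof.
  intros K0. apply Rmin_glb; [apply base_lipschitz|].
  unfold hop. pose proof (height_nonneg K x K0). pose proof (height_nonneg K y K0). lra.
Qed.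

Lemma river_ge_height (K : R -> Prop) (x y : R) : K 0 ->
  Rabs (height K x - height K y) <= river K x y.
Proof.
  intros K0. pose proof (height_nonneg K x K0). pose proof (height_nonneg K y K0).
  pose proof (Rabs_pos (base x - base y)). apply Rmin_glb.
  - pose proof (height_base_lipschitz K x y K0). lra.
  - unfold hop. apply Rabs_le. lra.
Qed.

(** The mixed case of the triangle inequality: a direct move changes the two coordinates by no more
    than its length. *)
Lemma hop_triangle_l (K : R -> Prop) (x y z : R) : K 0 ->
  hop K x z <= Rabs (x - y) + hop K y z.
Proof.
  intros K0. pose proof (height_base_lipschitz K x y K0).
  pose proof (Rle_abs (height K x - height K y)).
  pose proof (Rabs_triang (base x - base y) (base y - base z)) as Ht.
  replace (base x - base y + (base y - base z)) with (base x - base z) in Ht by ring.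
  unfold hop. lra.
Qed.

Lemma hop_sym (K : R -> Prop) (x y : R) : hop K x y = hop K y x.
Proof. unfold hop. rewrite (Rabs_minus_sym (base x)). ring. Qed.

Lemma river_metric (K : R -> Prop) : K 0 -> is_metric (river K).
Proof.
  intros K0. split; [|split; [|split]].
  - intros x y. pose proof (river_ge_base K x y K0). pose proof (Rabs_pos (base x - base y)). lra.
  - intros x y. split.
    + intros E.
      pose proof (height_nonneg K x K0) as Hx. pose proof (height_nonneg K y K0) as Hy.
      pose proof (Rabs_pos (base x - base y)) as Hb.
      unfold river, Rmin in E. destruct Rle_dec as [_|_].
      * apply Rminus_diag_uniq. destruct (Req_dec (x - y) 0) as [|Hn]; auto.
        apply Rabs_no_R0 in Hn. contradiction.
      * unfold hop in E.
        (* A hop of length 0 forces both heights to vanish, so both points lie on the half-line,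
           where [base] is the identity. *)
        assert (x <= 0) by (apply Rnot_lt_le; intros Hp; apply (height_pos K x K0) in Hp; lra).
        assert (y <= 0) by (apply Rnot_lt_le; intros Hp; apply (height_pos K y K0) in Hp; lra).
        rewrite !base_nonpos_eq in * by assumption.
        apply Rminus_diag_uniq. destruct (Req_dec (x - y) 0) as [|Hn]; auto.
        apply Rabs_pos_lt in Hn. lra.
    + intros ->. pose proof (river_ge_base K y y K0). pose proof (river_le K y y) as [H1 _].
      rewrite !Rminus_diag, Rabs_R0 in *. lra.
  - intros x y. unfold river. rewrite hop_sym, Rabs_minus_sym. reflexivity.
  - intros x y z.
    destruct (river_le K x z) as [H1 H2].
    pose proof (hop_triangle_l K x y z K0) as H3.
    pose proof (hop_triangle_l K z y x K0) as H4.
    rewrite (hop_sym K z x), (hop_sym K y x), (Rabs_minus_sym z y) in H4.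
    pose proof (Rabs_triang (x - y) (y - z)) as H5.
    replace (x - y + (y - z)) with (x - z) in H5 by ring.
    pose proof (Rabs_triang (base x - base y) (base y - base z)) as H6.
    replace (base x - base y + (base y - base z)) with (base x - base z) in H6 by ring.
    pose proof (height_nonneg K y K0) as H7.
    assert (H8 : hop K x z <= hop K x y + hop K y z) by (unfold hop; lra).
    unfold river at 2 3. unfold Rmin. repeat destruct Rle_dec; lra.
Qed.

Lemma cauchy_converges (v : nat -> R) :
  (forall e, 0 < e -> exists N, forall m n, (N <= m)%nat -> (N <= n)%nat ->
     Rabs (v m - v n) < e) ->
  exists l, forall e, 0 < e -> exists N, forall n, (N <= n)%nat -> Rabs (v n - l) < e.
Proof.
  intros Hv. destruct (Rcomplete.R_complete v) as [l Hl].
  - intros e He. destruct (Hv e He) as [N HN]. exists N. intros m n Hm Hn. apply HN; lia.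
  - exists l. intros e He. destruct (Hl e He) as [N HN]. exists N. intros n Hn. apply HN; lia.
Qed.

Lemma river_complete (K : R -> Prop) : K 0 -> metric_complete (river K).
Proof.
  intros K0 u Hu.
  destruct (cauchy_converges (fun n => base (u n))) as [b Hb].
  { intros e He. destruct (Hu e He) as [N HN]. exists N. intros m n Hm Hn.
    pose proof (river_ge_base K (u m) (u n) K0). specialize (HN m n Hm Hn). lra. }
  destruct (cauchy_converges (fun n => height K (u n))) as [h Hh].
  { intros e He. destruct (Hu e He) as [N HN]. exists N. intros m n Hm Hn.
    pose proof (river_ge_height K (u m) (u n) K0). specialize (HN m n Hm Hn). lra. }
  assert (Hb0 : b <= 0).
  { apply Rnot_lt_le. intros Hpos. destruct (Hb b Hpos) as [N HN].
    specialize (HN N (le_n N)). pose proof (base_le_0 (u N)).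
    apply Rabs_lt_between in HN. lra. }
  assert (Hh0 : 0 <= h).
  { apply Rnot_lt_le. intros Hneg. destruct (Hh (- h)) as [N HN]; [lra|].
    specialize (HN N (le_n N)). pose proof (height_nonneg K (u N) K0).
    apply Rabs_lt_between in HN. lra. }
  destruct (Rle_lt_or_eq_dec 0 h Hh0) as [Hpos | <-].
  - (* The sequence stays at height above [h / 2], where short distances are Euclidean. *)
    destruct (Hh (h / 2)) as [N1 HN1]; [lra|].
    destruct (cauchy_converges u) as [l Hl].
    { intros e He. destruct (Hu (Rmin e (h / 2))) as [N HN].
      { apply Rmin_glb_lt; lra. }
      exists (max N N1). intros m n Hm Hn.
      assert (Hd : river K (u m) (u n) < Rmin e (h / 2)) by (apply HN; lia).
      assert (Hm1 : Rabs (height K (u m) - h) < h / 2) by (apply HN1; lia).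
      apply Rabs_lt_between in Hm1.
      pose proof (Rmin_l e (h / 2)). pose proof (Rmin_r e (h / 2)).
      apply river_lt in Hd. destruct Hd as [Hd | Hd]; [lra|].
      unfold hop in Hd. pose proof (height_nonneg K (u n) K0).
      pose proof (Rabs_pos (base (u m) - base (u n))). lra. }
    exists l. intros e He. destruct (Hl e He) as [N HN]. exists N. intros n Hn.
    apply river_lt. left. apply HN, Hn.
  (* At limit height 0 the limit is the ground point [b], which is its own parameter because
     [b <= 0]. *)
  - exists b. intros e He.
    destruct (Hb (e / 2)) as [N1 HN1]; [lra|].
    destruct (Hh (e / 2)) as [N2 HN2]; [lra|].
    exists (max N1 N2). intros n Hn. apply river_lt. right. unfold hop.
    rewrite (height_nonpos_eq K b K0 Hb0), (base_nonpos_eq b Hb0).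
    specialize (HN1 n ltac:(lia)). specialize (HN2 n ltac:(lia)).
    apply Rabs_lt_between in HN2. lra.
Qed.

(** * Open sets of the metric, and clopen arcs of the tail *)

Lemma metric_open_topology (d : R -> R -> R) : is_topology (metric_open d).
Proof.
  split; [|split; [|split]].
  - intros x _. exists 1. split; [lra | auto].
  - intros x [].
  - intros U V HU HV x [Ux Vx].
    destruct (HU x Ux) as [a [Ha HaU]]. destruct (HV x Vx) as [b [Hb HbV]].
    exists (Rmin a b). split; [apply Rmin_glb_lt; assumption|].
    intros y Hy. pose proof (Rmin_l a b). pose proof (Rmin_r a b).
    split; [apply HaU | apply HbV]; lra.
  - intros F HF x [U [FU Ux]]. destruct (HF U FU x Ux) as [e [He HeU]].
    exists e. split; [exact He|]. intros y Hy. exists U. auto.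
Qed.

Lemma metric_open_ball (d : R -> R -> R) (x e : R) :
  is_metric d -> metric_open d (fun y => d x y < e).
Proof.
  intros [_ [_ [_ Htri]]] y Hy. exists (e - d x y). split; [lra|].
  intros z Hz. pose proof (Htri x y z). lra.
Qed.

Lemma metric_open_hausdorff (d : R -> R -> R) : is_metric d -> hausdorff (metric_open d).
Proof.
  intros Hd x y Hxy. pose proof Hd as [Hpos [Hid [Hsym Htri]]].
  assert (H0 : forall z, d z z = 0) by (intros z; apply Hid; reflexivity).
  assert (Hxy0 : 0 < d x y).
  { destruct (Hpos x y) as [H | H]; [exact H|]. elim Hxy. apply Hid. auto. }
  exists (fun z => d x z < d x y / 2), (fun z => d y z < d x y / 2).
  split; [|split; [|split; [|split]]]; try (apply metric_open_ball, Hd).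
  - rewrite H0. lra.
  - rewrite H0. lra.
  - intros z [H1 H2]. pose proof (Htri x z y). rewrite (Hsym y z) in H2. lra.
Qed.

Lemma river_coarser (K : R -> Prop) : coarser (metric_open (river K)) eta.
Proof.
  intros U HU x Ux. destruct (HU x Ux) as [e [He HeU]]. exists e. split; [exact He|].
  intros y Hy. apply HeU. rewrite Rabs_minus_sym in Hy. apply river_lt. auto.
Qed.

(** A hop from [x] costs at least [height K x], so a smaller ball contains only direct moves. *)
Lemma river_ball_tail (K : R -> Prop) (x y e : R) : K 0 ->
  river K x y < Rmin (height K x) e -> Rabs (y - x) < e.
Proof.
  intros K0 Hd. pose proof (Rmin_l (height K x) e). pose proof (Rmin_r (height K x) e).
  rewrite Rabs_minus_sym. apply river_lt in Hd. destruct Hd as [Hd | Hd]; [lra|].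
  unfold hop in Hd. pose proof (height_nonneg K y K0). pose proof (Rabs_pos (base x - base y)). lra.
Qed.

Lemma river_open_tail (K : R -> Prop) (V : R -> Prop) : K 0 ->
  (forall x, V x -> 0 < x) -> eta V -> metric_open (river K) V.
Proof.
  intros K0 Hpos HV x Vx. destruct (HV x Vx) as [e [He HeV]].
  exists (Rmin (height K x) e). split.
  - apply Rmin_glb_lt; [apply height_pos; auto | exact He].
  - intros y Hy. apply HeV. exact (river_ball_tail K x y e K0 Hy).
Qed.

(** On the compact arc [[m, M]] the height has a positive lower bound, so ground points keep a
    positive distance from the arc. *)
Lemma river_open_outside (K : R -> Prop) (m M : R) : K 0 -> 0 < m <= M ->
  metric_open (river K) (fun z => z < m \/ M < z).
Proof.
  intros K0 HmM x Hx. destruct (Rlt_le_dec 0 x) as [Hpos | Hneg].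
  - assert (He : exists e, 0 < e /\ forall y, Rabs (y - x) < e -> y < m \/ M < y).
    { destruct Hx as [Hx | Hx].
      - exists (m - x). split; [lra|]. intros y Hy. apply Rabs_lt_between in Hy. lra.
      - exists (x - M). split; [lra|]. intros y Hy. apply Rabs_lt_between in Hy. lra. }
    destruct He as [e [He HeV]].
    exists (Rmin (height K x) e). split.
    + apply Rmin_glb_lt; [apply height_pos; auto | exact He].
    + intros y Hy. apply HeV. exact (river_ball_tail K x y e K0 Hy).
  - set (c := Rmin m (/ (1 + M)) / 4).
    assert (Hc : 0 < c) by (apply decay_ge_min_pos; lra).
    exists (Rmin m c). split; [apply Rmin_glb_lt; lra|].
    intros y Hy. pose proof (Rmin_l m c). pose proof (Rmin_r m c).
    destruct (Rlt_le_dec y m); [auto|]. destruct (Rlt_le_dec M y); [auto|]. exfalso.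
    assert (c <= height K y).
    { apply Rle_trans with (decay y); [apply decay_ge; lra | apply height_ge_decay; [auto | lra]]. }
    apply river_lt in Hy. destruct Hy as [Hy | Hy].
    + apply Rabs_lt_between in Hy. lra.
    + unfold hop in Hy. pose proof (height_nonneg K x K0).
      pose proof (Rabs_pos (base x - base y)). lra.
Qed.

(** Once [U] misses the parameters [m] and [M], the open arc between them splits off from the rest
    of [U]. *)
Lemma river_separates (K : R -> Prop) (U : R -> Prop) (x m y M : R) : K 0 ->
  0 < m -> m < y < M -> x < m -> ~ U m -> ~ U M ->
  exists C D, metric_open (river K) C /\ metric_open (river K) D /\ D x /\ C y /\
    (forall z, ~ (C z /\ D z)) /\ (forall z, U z -> C z \/ D z).
Proof.
  intros K0 Hm Hy Hx Um UM.
  exists (fun z => m < z < M), (fun z => z < m \/ M < z).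
  split; [|split; [|split; [|split; [|split]]]].
  - apply river_open_tail; [exact K0 | intros z Hz; lra|].
    intros z Hz. exists (Rmin (z - m) (M - z)). split; [apply Rmin_glb_lt; lra|].
    intros w Hw. pose proof (Rmin_l (z - m) (M - z)). pose proof (Rmin_r (z - m) (M - z)).
    apply Rabs_lt_between in Hw. lra.
  - apply river_open_outside; [exact K0 | lra].
  - auto.
  - exact Hy.
  - intros z. lra.
  - intros z Uz.
    destruct (Rtotal_order z m) as [H | [-> | H]]; [auto | contradiction |].
    destruct (Rtotal_order z M) as [H' | [-> | H']]; [auto | contradiction | auto].
Qed.

(* A tail point [y] near [x <= 0] is cut off by parameters [m < y < M] at which the curve is away from [x]. *)
Lemma river_small_quasicomponents (K : R -> Prop) : K 0 ->
  small_quasicomponents (metric_open (river K)).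
Proof.
  intros K0 x e He. pose proof (river_metric K K0) as Hd.
  assert (Hxx : river K x x = 0) by (apply Hd; reflexivity).
  assert (Hball : forall r, 0 < r ->
      metric_open (river K) (fun y => river K x y < r) /\ river K x x < r).
  { intros r Hr. split; [apply metric_open_ball, Hd | lra]. }
  destruct (Rlt_le_dec 0 x) as [Hpos | Hneg].
  { exists (fun y => river K x y < Rmin (height K x) e).
    pose proof (height_pos K x K0 Hpos) as Hh.
    destruct (Hball (Rmin (height K x) e)) as [H1 H2]; [apply Rmin_glb_lt; lra|].
    split; [exact H1|]. split; [exact H2|]. intros y Uy Hfar.
    apply (river_ball_tail K x y e K0) in Uy. lra. }
  (* The far end of the arc will be a parameter over [x - 1], which no hop of length below 1 reaches
     from [x]. *)
  assert (HhopM : forall M, base M = x - 1 -> 1 <= hop K x M).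
  { intros M E. unfold hop. rewrite E, (base_nonpos_eq x Hneg).
    pose proof (height_nonneg K x K0). pose proof (height_nonneg K M K0).
    replace (x - (x - 1)) with 1 by ring. rewrite Rabs_R1. lra. }
  assert (Hcut : exists r, 0 < r <= e /\ r <= 1 /\
      forall y, river K x y < r -> e <= Rabs (y - x) -> 0 < y ->
        exists m, 0 < m < y /\ ~ river K x m < r).
  { destruct (Rlt_le_dec x 0) as [Hx | Hx].
    (* For [x < 0] the tail starts near 0, away from [x]: up to parameter [- x / 2] its base stays
       above [x / 2], so an early [m] serves. *)
    - exists (Rmin (Rmin e 1) (- x / 2)).
      set (r := Rmin (Rmin e 1) (- x / 2)).
      assert (Hr : 0 < r) by (unfold r; repeat apply Rmin_glb_lt; lra).
      assert (Hre : r <= e /\ r <= 1 /\ r <= - x / 2).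
      { unfold r, Rmin. repeat destruct Rle_dec; lra. }
      split; [lra|]. split; [lra|]. intros y _ _ Hy.
      exists (Rmin (y / 2) (- x / 2)).
      assert (Hm : 0 < Rmin (y / 2) (- x / 2) < y /\ Rmin (y / 2) (- x / 2) <= - x / 2).
      { unfold Rmin. destruct Rle_dec; lra. }
      set (m := Rmin (y / 2) (- x / 2)) in *.
      split; [lra|]. intros Hlt. apply river_lt in Hlt.
      destruct Hlt as [Hlt | Hlt].
      + apply Rabs_lt_between in Hlt. lra.
      + pose proof (base_lipschitz m 0) as Hb.
        rewrite (base_nonpos_eq 0) in Hb by lra.
        rewrite Rminus_0_r, Rminus_0_r, (Rabs_right m) in Hb by lra.
        unfold hop in Hlt. rewrite (base_nonpos_eq x Hneg) in Hlt.
        pose proof (height_nonneg K x K0). pose proof (height_nonneg K m K0).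
        pose proof (Rle_abs (base m - x)) as Hc. rewrite Rabs_minus_sym in Hc.
        pose proof (Rle_abs (- base m)) as Hb'. rewrite Rabs_Ropp in Hb'. lra.
    - assert (x = 0) as -> by lra.
      (* The tail starts at [x = 0] itself, so the cut is made at [e / 2], and the radius is kept
         below the height there. *)
      exists (Rmin (Rmin e 1) (Rmin (e / 2) (height K (e / 2)))).
      pose proof (height_pos K (e / 2) K0) as Hh.
      set (r := Rmin (Rmin e 1) (Rmin (e / 2) (height K (e / 2)))).
      assert (Hr : 0 < r) by (unfold r; repeat apply Rmin_glb_lt; lra).
      assert (Hre : r <= e /\ r <= 1 /\ r <= e / 2 /\ r <= height K (e / 2)).
      { unfold r, Rmin. repeat destruct Rle_dec; lra. }
      split; [lra|]. split; [lra|]. intros y _ Hfar Hy.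
      rewrite Rminus_0_r, Rabs_right in Hfar by lra.
      exists (e / 2). split; [lra|]. intros Hlt. apply river_lt in Hlt.
      destruct Hlt as [Hlt | Hlt].
      + apply Rabs_lt_between in Hlt. lra.
      + unfold hop in Hlt. pose proof (height_nonneg K 0 K0).
        pose proof (Rabs_pos (base 0 - base (e / 2))). lra. }
  destruct Hcut as [r [Hr [Hr1 Hcut]]].
  destruct (Hball r (proj1 Hr)) as [H1 H2].
  exists (fun y => river K x y < r). split; [exact H1|]. split; [exact H2|].
  intros y Uy Hfar.
  (* Between ground points direct moves and hops both have Euclidean length, so a far point of the
     ball lies on the tail. *)
  assert (Hy : 0 < y).
  { apply Rnot_le_lt. intros Hy. pose proof Uy as Uy'. rewrite Rabs_minus_sym in Hfar.
    apply river_lt in Uy'. unfold hop in Uy'.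
    rewrite (base_nonpos_eq x Hneg), (base_nonpos_eq y Hy) in Uy'.
    pose proof (height_nonneg K x K0). pose proof (height_nonneg K y K0). lra. }
  destruct (Hcut y Uy Hfar Hy) as [m [Hm Um]].
  destruct (base_surjective_late (x - 1) y) as [M [HyM HM]]; [lra|].
  apply (river_separates K _ x m y M K0); try lra; auto.
  intros UM. apply river_lt in UM. destruct UM as [UM | UM].
  - rewrite Rabs_right in Hfar by lra. apply Rabs_lt_between in UM. lra.
  - pose proof (HhopM M HM). lra.
Qed.

(** * Recognizing [K] from the topology *)

(** Over a point of [K] the [gap] term vanishes, and arbitrarily late parameters come arbitrarily
    low. Near a point off [K] that term keeps the tail up. *)
Lemma river_eta_neighborhoods (K : R -> Prop) (x : R) : K 0 ->
  (forall x, K x -> x <= 0) ->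
  (forall x, x <= 0 -> ~ K x -> exists c, 0 < c /\ forall y, K y -> c <= Rabs (x - y)) ->
  (eta_neighborhoods_at (metric_open (river K)) x <-> ~ K x).
Proof.
  intros K0 Kneg Kclosed. pose proof (river_metric K K0) as Hd.
  assert (Hxx : river K x x = 0) by (apply Hd; reflexivity).
  split.
  - intros Hreg Kx. pose proof (Kneg x Kx) as Hx.
    destruct (Hreg 1 Rlt_0_1) as [U [HU [Ux HU1]]].
    destruct (HU x Ux) as [e [He HeU]].
    assert (Hinv : 0 < / e) by (apply Rinv_0_lt_compat, He).
    (* Lateness [/ e] pushes [decay] below [e]; the extra 1 keeps [t] at Euclidean distance above 1
       from [x <= 0]. *)
    destruct (base_surjective_late x (1 + / e) Hx) as [t [Ht E]].
    assert (Hfar : Rabs (t - x) < 1).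
    { apply HU1, HeU, river_lt. right. unfold hop.
      rewrite E, (base_nonpos_eq x Hx), Rminus_diag, Rabs_R0, (height_nonpos_eq K x K0 Hx).
      unfold height. rewrite Rmax_left by lra.
      rewrite <- base_pos_eq, E, (gap_mem K x Kx) by lra.
      assert (/ (1 + t) < e).
      { rewrite <- (Rinv_inv e). apply Rinv_lt_contravar; [|lra].
        apply Rmult_lt_0_compat; lra. }
      unfold decay. pose proof (Rmin_r t (/ (1 + t))). lra. }
    apply Rabs_lt_between in Hfar. lra.
  - intros NK e He.
    destruct (Rlt_le_dec 0 x) as [Hpos | Hneg].
    + exists (fun y => river K x y < Rmin (height K x) e).
      split; [apply metric_open_ball, Hd|]. split.
      * rewrite Hxx. apply Rmin_glb_lt; [apply height_pos; auto | exact He].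
      * intros y. apply river_ball_tail, K0.
    + destruct (Kclosed x Hneg NK) as [c [Hc HcK]].
      (* As [gap] is 1-Lipschitz and at least [c] at [x], a hop from [x] to the tail is longer than
         [c / 2]. *)
      exists (fun y => river K x y < Rmin e (c / 4)).
      split; [apply metric_open_ball, Hd|]. split.
      * rewrite Hxx. apply Rmin_glb_lt; lra.
      * intros y Hy. pose proof (Rmin_l e (c / 4)). pose proof (Rmin_r e (c / 4)).
        rewrite Rabs_minus_sym.
        apply river_lt in Hy. destruct Hy as [Hy | Hy]; [lra|].
        unfold hop in Hy. rewrite (height_nonpos_eq K x K0 Hneg), (base_nonpos_eq x Hneg) in Hy.
        destruct (Rle_lt_dec y 0) as [Hy0 | Hy0].
        { rewrite (base_nonpos_eq y Hy0), (height_nonpos_eq K y K0 Hy0) in Hy. lra. }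
        exfalso. unfold height in Hy. rewrite Rmax_left, base_pos_eq in Hy by lra.
        pose proof (decay_pos y Hy0).
        pose proof (proj2 (gap_glb K 0 x K0) c HcK).
        pose proof (gap_lipschitz K 0 x (sweep y) K0) as Hl.
        pose proof (Rle_abs (gap K x - gap K (sweep y))). 
        pose proof (Rabs_pos (x - sweep y)). lra.
Qed.

(** * The closed sets coding sets of natural numbers *)

Definition blocks (S : nat -> Prop) (x : R) : Prop :=
  exists n, x = - INR n \/ (S n /\ - INR n - 1 / 2 <= x <= - INR n).

Lemma blocks_opp_INR (S : nat -> Prop) (n : nat) : blocks S (- INR n).
Proof. exists n. auto. Qed.

Lemma blocks_0 (S : nat -> Prop) : blocks S 0.
Proof. rewrite <- Ropp_0. exact (blocks_opp_INR S 0). Qed.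

Lemma blocks_nonpos (S : nat -> Prop) (x : R) : blocks S x -> x <= 0.
Proof. intros [n Hn]. pose proof (pos_INR n). lra. Qed.

(** Blocks have length at most 1/2, so strictly between [- INR n - 1] and [- INR n] only the block
    of [n] can show up. *)
Lemma blocks_cases (S : nat -> Prop) (n : nat) (y : R) : blocks S y ->
  y <= - INR n - 1 \/ - INR n <= y \/ (S n /\ - INR n - 1 / 2 <= y <= - INR n).
Proof.
  intros [m Hm].
  assert (HI : forall i j : nat, (i < j)%nat -> INR i + 1 <= INR j).
  { intros i j Hij. rewrite <- S_INR. apply le_INR. exact Hij. }
  destruct (lt_eq_lt_dec m n) as [[Hlt | ->] | Hlt].
  - apply HI in Hlt. lra.
  - destruct Hm as [-> | Hm]; [right; left; lra | auto].
  - apply HI in Hlt. lra.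
Qed.

Lemma blocks_closed (S : nat -> Prop) (x : R) : x <= 0 -> ~ blocks S x ->
  exists c, 0 < c /\ forall y, blocks S y -> c <= Rabs (x - y).
Proof.
  intros Hx NK. destruct (nfloor_ex (- x)) as [n Hn]; [lra|].
  assert (Hne : x <> - INR n) by (intros ->; apply NK, blocks_opp_INR).
  destruct (classic (S n)) as [Sn | NSn].
  - assert (Hlow : x < - INR n - 1 / 2).
    { apply Rnot_le_lt. intros H. apply NK. exists n. right. split; [exact Sn | lra]. }
    exists (Rmin (x + INR n + 1) (- INR n - 1 / 2 - x)).
    split; [apply Rmin_glb_lt; lra|]. intros y Ky.
    pose proof (Rmin_l (x + INR n + 1) (- INR n - 1 / 2 - x)).
    pose proof (Rmin_r (x + INR n + 1) (- INR n - 1 / 2 - x)).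
    destruct (blocks_cases S n y Ky) as [H' | [H' | [_ H']]];
      unfold Rabs; destruct Rcase_abs; lra.
  - exists (Rmin (x + INR n + 1) (- INR n - x)).
    split; [apply Rmin_glb_lt; lra|]. intros y Ky.
    pose proof (Rmin_l (x + INR n + 1) (- INR n - x)).
    pose proof (Rmin_r (x + INR n + 1) (- INR n - x)).
    destruct (blocks_cases S n y Ky) as [H' | [H' | [H' _]]];
      [ | | contradiction]; unfold Rabs; destruct Rcase_abs; lra.
Qed.

(** An order-theoretic description of the right ends of the components, hence one that increasing
    bijections preserve. *)
Definition right_isolated (K : R -> Prop) (x : R) : Prop :=
  K x /\ exists b, x < b /\ forall y, x < y < b -> ~ K y.

Lemma right_isolated_blocks (S : nat -> Prop) (x : R) :
  right_isolated (blocks S) x <-> exists n, x = - INR n.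
Proof.
  split.
  - intros [[n [E | [Sn Hn]]] [b [Hb Hfree]]]; [exists n; exact E|].
    exists n. apply Rle_antisym; [lra|]. apply Rnot_lt_le. intros Hlt.
    set (y := (x + Rmin b (- INR n)) / 2).
    assert (Hy : x < y < b /\ y < - INR n) by (unfold y, Rmin; destruct Rle_dec; lra).
    apply (Hfree y (proj1 Hy)). exists n. right. split; [exact Sn | lra].
  - intros [n ->]. split; [apply blocks_opp_INR|].
    exists (- INR n + 1 / 2). split; [lra|]. intros y Hy Ky.
    destruct n as [|p].
    + simpl INR in Hy. pose proof (blocks_nonpos S y Ky). lra.
    + rewrite S_INR in Hy. destruct (blocks_cases S p y Ky); lra.
Qed.

Lemma right_isolated_image (K K' : R -> Prop) (f g : R -> R) (x : R) :
  (forall y, f (g y) = y) -> (forall x y, x < y -> f x < f y) ->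
  (forall x, K x <-> K' (f x)) -> (right_isolated K x <-> right_isolated K' (f x)).
Proof.
  intros Hfg Hinc HK.
  assert (Hrefl : forall u v, f u < f v -> u < v).
  { intros u v Huv. destruct (Rtotal_order u v) as [H | [-> | H]]; [exact H | lra |].
    apply Hinc in H. lra. }
  unfold right_isolated. rewrite <- HK. split; intros [Kx [b [Hb Hfree]]]; split; auto.
  - exists (f b). split; [apply Hinc, Hb|]. intros y Hy. rewrite <- (Hfg y) in *.
    rewrite <- HK. apply Hfree. split; apply Hrefl, Hy.
  - exists (g b). split; [apply Hrefl; rewrite Hfg; exact Hb|]. intros y Hy.
    rewrite HK. apply Hfree. rewrite <- (Hfg b). split; apply Hinc, Hy.
Qed.

(** The map restricts to an increasing bijection of the nonpositive integers, which are well-ordered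
    downwards from 0, so it is the identity on them. *)
Lemma blocks_increasing_fixes (S S' : nat -> Prop) (f g : R -> R) :
  (forall y, f (g y) = y) -> (forall x y, x < y -> f x < f y) ->
  (forall x, blocks S x <-> blocks S' (f x)) -> forall n, f (- INR n) = - INR n.
Proof.
  intros Hfg Hinc HK.
  assert (Himage : forall n, exists m, f (- INR n) = - INR m).
  { intros n. apply (right_isolated_blocks S').
    apply (right_isolated_image (blocks S) (blocks S') f g); auto.
    apply right_isolated_blocks. exists n. reflexivity. }
  assert (Hpre : forall m, exists n, f (- INR n) = - INR m).
  { intros m. destruct (proj1 (right_isolated_blocks S (g (- INR m)))) as [n Hn].
    - apply (right_isolated_image (blocks S) (blocks S') f g); auto.
      rewrite Hfg. apply right_isolated_blocks. exists m. reflexivity.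
    - exists n. rewrite <- Hn. apply Hfg. }
  assert (Hmono : forall i j, (i <= j)%nat -> f (- INR j) <= f (- INR i)).
  { intros i j Hij. apply le_INR in Hij.
    destruct (Rle_lt_or_eq_dec _ _ Hij) as [H | ->]; [|lra].
    left. apply Hinc. lra. }
  induction n as [n IH] using lt_wf_ind.
  destruct (Himage n) as [m Hm]. destruct (Hpre n) as [k Hk].
  (* An image or preimage index below [n] would already be fixed by induction, against
     injectivity. *)
  assert (Hkn : (n <= k)%nat).
  { destruct (le_lt_dec n k) as [|Hlt]; [assumption|].
    pose proof (IH k Hlt) as E. rewrite E in Hk. apply lt_INR in Hlt. lra. }
  assert (Hmn : (n <= m)%nat).
  { destruct (le_lt_dec n m) as [|Hlt]; [assumption|].
    pose proof (IH m Hlt) as E. apply lt_INR in Hlt.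
    pose proof (Hinc (- INR n) (- INR m)). lra. }
  apply Hmono in Hkn. apply le_INR in Hmn. lra.
Qed.

Lemma blocks_monotone_invariant (S S' : nat -> Prop) (f g : R -> R) :
  (forall y, f (g y) = y) ->
  (forall x y, x < y -> f x < f y) \/ (forall x y, x < y -> f y < f x) ->
  (forall x, blocks S x <-> blocks S' (f x)) -> forall n, S n -> S' n.
Proof.
  intros Hfg [Hinc | Hdec] HK n Sn.
  - pose proof (blocks_increasing_fixes S S' f g Hfg Hinc HK n) as Hn.
    pose proof (Hinc (- INR n - 1 / 2) (- INR n)) as Ha.
    (* This point lies in the image of the block of [n], hence in [blocks S'], and within distance 1
       to the left of [- INR n], where only the block of [n] in [S'] has points. *)
    set (y := (- INR n + Rmax (f (- INR n - 1 / 2)) (- INR n - 1)) / 2).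
    assert (Hy : f (- INR n - 1 / 2) < y < - INR n /\ - INR n - 1 < y).
    { unfold y, Rmax. destruct Rle_dec; lra. }
    assert (Ky : blocks S' y).
    { rewrite <- (Hfg y). apply HK. exists n. right. split; [exact Sn|].
      split; apply Rnot_lt_le; intros H; apply Hinc in H; rewrite Hfg in H; lra. }
    destruct (blocks_cases S' n y Ky) as [H | [H | [H _]]]; lra || exact H.
  (* A decreasing map is impossible, as both sets are bounded above and unbounded below: the
     preimage of a point of [blocks S'] below [f 0] would be positive. *)
  - exfalso. destruct (INR_unbounded (- f 0)) as [m Hm].
    assert (Kg : blocks S (g (- INR m))) by (apply HK; rewrite Hfg; apply blocks_opp_INR).
    apply blocks_nonpos in Kg.
    destruct (Rle_lt_or_eq_dec _ _ Kg) as [H | H].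
    + apply Hdec in H. rewrite Hfg in H. lra.
    + rewrite <- H, Hfg in Hm. lra.
Qed.

(** Both topologies are coarser than [eta], so [f] and [g] are paths and thus Euclidean continuous.
    The inverse homeomorphism will give the other inclusion. *)
Lemma blocks_homeomorphic_incl (S S' : nat -> Prop) :
  homeomorphic (metric_open (river (blocks S))) (metric_open (river (blocks S'))) ->
  forall n, S n -> S' n.
Proof.
  intros [f [g [Hgf [Hfg [Hf Hg]]]]].
  assert (Hfc : eta_continuous f).
  { apply (eta_continuous_of_continuous (metric_open (river (blocks S')))).
    - apply river_small_quasicomponents, blocks_0.
    - intros V HV. apply (river_coarser (blocks S)), Hf, HV. }
  assert (Hgc : eta_continuous g).
  { apply (eta_continuous_of_continuous (metric_open (river (blocks S)))).
    - apply river_small_quasicomponents, blocks_0.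
    - intros V HV. apply (river_coarser (blocks S')), Hg, HV. }
  apply (blocks_monotone_invariant S S' f g Hfg).
  - apply continuous_injective_monotone; [apply eta_continuous_continuity, Hfc|].
    intros x y E. rewrite <- (Hgf x), E. apply Hgf.
  - assert (Hreg : forall A x, eta_neighborhoods_at (metric_open (river (blocks A))) x
        <-> ~ blocks A x).
    { intros A x. apply river_eta_neighborhoods;
        [apply blocks_0 | apply blocks_nonpos | apply blocks_closed]. }
    intros x. split; intros Kx; apply NNPP; rewrite <- Hreg; intros H.
    + apply (eta_neighborhoods_homeo _ _ g f _ Hfg Hgf Hf Hgc) in H.
      rewrite Hgf in H. apply Hreg in H. contradiction.
    + apply (eta_neighborhoods_homeo _ _ f g _ Hgf Hfg Hg Hfc) in H.
      apply Hreg in H. contradiction.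
Qed.

(** * Continuum many sets of natural numbers *)

Lemma homeomorphic_sym (tau sigma : topology_on_R) :
  homeomorphic tau sigma -> homeomorphic sigma tau.
Proof. intros [f [g [Hgf [Hfg [Hf Hg]]]]]. exists g, f. auto. Qed.

(* [n] codes the rational [(a - b) / (c + 1)]. *)
Definition cut (r : R) (n : nat) : Prop :=
  let (a, p) := of_nat n in let (b, c) := of_nat p in
  INR a - INR b < r * INR (S c).

Lemma cut_incl_le (r s : R) : (forall n, cut r n -> cut s n) -> r <= s.
Proof.
  intros Hincl. apply Rnot_lt_le. intros Hsr.
  (* With this denominator [s] and [r], scaled by [INR (S c)], differ by more than 1, so the first
     integer above the smaller one lies below the larger. *)
  destruct (INR_unbounded (/ (r - s))) as [c Hc].
  assert (Hq : 1 < (r - s) * INR (S c)).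
  { rewrite S_INR. pose proof (Rinv_r (r - s)). nra. }
  set (z := up (s * INR (S c))).
  pose proof (archimed (s * INR (S c))) as Hz. fold z in Hz.
  (* [Z.to_nat] sends negative integers to 0, so the two terms are the positive and negative parts
     of [z]. *)
  assert (E : INR (Z.to_nat z) - INR (Z.to_nat (- z)) = IZR z).
  { rewrite !INR_IZR_INZ, <- minus_IZR. f_equal. lia. }
  specialize (Hincl (to_nat (Z.to_nat z, to_nat (Z.to_nat (- z), c)))).
  unfold cut in Hincl. rewrite !cancel_of_to, E in Hincl.
  assert (IZR z < s * INR (S c)) by (apply Hincl; lra). lra.
Qed.

(* A family of continuum many topologies, indexed by R (|R| = c). *)
Theorem theorem4 :
  exists T : R -> topology_on_R,
    (forall r, in_L (T r) /\ completely_metrizable (T r)) /\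
    (forall r s, r <> s -> ~ homeomorphic (T r) (T s)).
Proof.
  exists (fun r => metric_open (river (blocks (cut r)))). split.
  - intros r. pose proof (river_metric _ (blocks_0 (cut r))) as Hd. split.
    + split; [apply metric_open_topology|].
      split; [apply metric_open_hausdorff, Hd | apply river_coarser].
    + exists (river (blocks (cut r))). split; [exact Hd|]. split.
      * apply river_complete, blocks_0.
      * intros U. reflexivity.
  - intros r s Hrs Hhom. apply Hrs, Rle_antisym; apply cut_incl_le, blocks_homeomorphic_incl.
    + exact Hhom.
    + apply homeomorphic_sym, Hhom.
Qed.
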